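(* Let $K$ be a field, let $x$ and $y$ be disjoint finite lists of indeterminates, and let $f\in K[x]$, $g\in K[y]$. For $3$-matrix factorizations $X\in MF(K[x],f)_3$ and $X'\in MF(K[y],g)_3$, there is a natural isomorphism $$X\,\overline{\otimes}_3\,X'\;\cong\;X'\,\overline{\otimes}_3\,X$$ in $MF(K[x,y],fg)_3$.
   Context: For a list of indeterminates $x$, $K(x)$ denotes the field of fractions of $K[x]$. Matrices over $K(x)$ or over $K(y)$ are regarded as matrices over $K(x,y)$. A $3$-matrix factorization of size $n$ of a polynomial $f\in K[x]$ is a triplet $(\phi,\psi,\theta)$ of $n\times n$ matrices with entries in $K(x)$ such that $\phi\psi\theta=fI_n$. The category $MF(K[x],f)_3$ has as objects the $3$-matrix factorizations of $f$ (of all sizes). A morphism from $(\phi_1,\psi_1,\theta_1)$ of size $n_1$ to $(\phi_2,\psi_2,\theta_2)$ of size $n_2$ is a triplet $(\alpha,\beta,\delta)$ of $n_2\times n_1$ matrices over $K(x)$ such that $\alpha\phi_1=\phi_2\beta$, $\psi_2\delta=\beta\psi_1$ and $\delta\theta_1=\theta_2\alpha$. Composition is componentwise matrix multiplication, and the identity of an object of size $n$ is $(I_n,I_n,I_n)$. The categories $MF(K[y],g)_3$ and $MF(K[x,y],fg)_3$ are defined in the same way. The multiplicative tensor product of $3$-matrix factorizations of polynomials in disjoint lists of indeterminates is $(\phi,\psi,\theta)\,\overline{\otimes}_3\,(\phi',\psi',\theta')=(\phi\otimes\phi',\psi\otimes\psi',\theta\otimes\theta')$, where $\otimes$ is the standard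 tensor (Kronecker) product of matrices; it is a $3$-matrix factorization of the product of the two polynomials. On morphisms, $(\alpha_f,\beta_f,\delta_f)\,\overline{\otimes}_3\,(\alpha_g,\beta_g,\delta_g)=(\alpha_f\otimes\alpha_g,\beta_f\otimes\beta_g,\delta_f\otimes\delta_g)$. ''Natural'' means natural in both $X$ and $X'$ with respect to this action on morphisms. *)

(* Defs.v *)
From HB Require Import structures.
From mathcomp Require Import all_boot all_order all_algebra fraction generic_quotient.
From mathcomp Require Import mxtens mpoly.

Set Implicit Arguments.
Unset Strict Implicit.
Unset Printing Implicit Defensive.

Import GRing.Theory.
Local Open Scope ring_scope.
Local Open Scope quotient_scope.

Notation "p %:F" := (@FracField.tofrac _ p) : ring_scope.

(* {fraction R} has no functoriality in the library. The value below does not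
   depend on the chosen representative of u because h is injective: see
   fracmap_div. *)
Section FracMap.
Variables (R S : idomainType) (h : {rmorphism R -> S}) (hI : injective h).

Definition fracmap of injective h := fun u : {fraction R} =>
  (h \n_(repr u))%:F / (h \d_(repr u))%:F.

Local Notation hF := (fracmap hI).

Lemma fracE (u : {fraction R}) : u = (\n_(repr u))%:F / (\d_(repr u))%:F.
Proof.
have d0 := denom_ratioP (repr u); have dF0 : (\d_(repr u))%:F != 0 :> {fraction R}.
  by rewrite tofrac_eq0.
apply/eqP; rewrite -subr_eq0 -(mulIr_eq0 _ (mulIf dF0)) mulrBl divfK // subr_eq0.
set x := repr u; rewrite -[u]reprK -/x /FracField.tofrac; unlock.
rewrite /GRing.mul /= -FracField.pi_mul; apply/eqP/eqmodP => /=.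
rewrite /FracField.equivf /FracField.mulf !numden_Ratio ?oner_neq0 ?mulr1 //.
by rewrite mulrC.
Qed.

Let hn0 c : c != 0 -> (h c)%:F != 0 :> {fraction S}.
Proof. by move=> c0; rewrite tofrac_eq0 -(rmorph0 h) (inj_eq hI). Qed.

Lemma fracmap_div (a b : R) : b != 0 -> hF (a%:F / b%:F) = (h a)%:F / (h b)%:F.
Proof.
move=> b0; set u := _ / _; rewrite /fracmap.
have d0 := denom_ratioP (repr u).
apply/eqP; rewrite eqr_div ?hn0 // -!tofracM -!rmorphM tofrac_eq (inj_eq hI).
by rewrite -tofrac_eq !tofracM -eqr_div ?tofrac_eq0 // -fracE.
Qed.

Lemma fracmapF (p : R) : hF p%:F = (h p)%:F.
Proof. by rewrite -[p%:F]divr1 -tofrac1 fracmap_div ?oner_neq0 // rmorph1 tofrac1 divr1. Qed.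

Lemma fracmap_is_zmod_morphism : zmod_morphism hF.
Proof.
move=> u v; rewrite [u]fracE [v]fracE.
have d0 := denom_ratioP (repr u); have e0 := denom_ratioP (repr v).
rewrite -mulNr addf_div ?tofrac_eq0 // -tofracN -!tofracM -tofracD.
rewrite !fracmap_div ?mulf_neq0 // -mulNr addf_div ?hn0 //.
by rewrite -tofracN -!tofracM -tofracD rmorphD !rmorphM rmorphN.
Qed.

Lemma fracmap_is_monoid_morphism : monoid_morphism hF.
Proof.
split; first by rewrite -tofrac1 fracmapF rmorph1 tofrac1.
move=> u v; rewrite [u]fracE [v]fracE.
have d0 := denom_ratioP (repr u); have e0 := denom_ratioP (repr v).
rewrite mulf_div -!tofracM !fracmap_div ?mulf_neq0 // mulf_div.
by rewrite -!tofracM !rmorphM.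
Qed.

HB.instance Definition _ := GRing.isZmodMorphism.Build _ _ (fracmap hI)
  fracmap_is_zmod_morphism.
HB.instance Definition _ := GRing.isMonoidMorphism.Build _ _ (fracmap hI)
  fracmap_is_monoid_morphism.
End FracMap.

(* x is the list of the first m indeterminates of {mpoly K[m + n]}, and y the
   list of the last n ones; tens_xy and tens_yx below are named accordingly. *)
Section Inclusions.
Variables (K : fieldType) (m n : nat).

Definition xvars : m.-tuple {mpoly K[m + n]} := [tuple 'X_(lshift n i) | i < m].
Definition yvars : n.-tuple {mpoly K[m + n]} := [tuple 'X_(rshift m j) | j < n].

Definition inx : {rmorphism {mpoly K[m]} -> {mpoly K[m + n]}} := comp_mpoly xvars.
Definition iny : {rmorphism {mpoly K[n]} -> {mpoly K[m + n]}} := comp_mpoly yvars.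

Lemma comp_mpolyK k l (s : k.-tuple {mpoly K[l]}) (t : l.-tuple {mpoly K[k]}) :
  (forall i, tnth s i \mPo t = 'X_i) -> cancel (comp_mpoly s) (comp_mpoly t).
Proof.
move=> st p; rewrite (comp_mpolyEX p) raddf_sum [RHS]mpolyE; apply: eq_bigr => u _ /=.
rewrite comp_mpolyZ comp_mpolyX rmorph_prod mpolyXE_id; congr (_ *: _).
by apply: eq_bigr => i _; rewrite rmorphXn /= st.
Qed.

Lemma inx_inj : injective inx.
Proof.
apply: can_inj (comp_mpolyK (t := [tuple if split i is inl k then 'X_k else 0 | i < m + n]) _).
by move=> i; rewrite tnth_mktuple comp_mpolyXU -tnth_nth tnth_mktuple (unsplitK (inl i)).
Qed.

Lemma iny_inj : injective iny.
Proof.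
apply: can_inj (comp_mpolyK (t := [tuple if split i is inr k then 'X_k else 0 | i < m + n]) _).
by move=> i; rewrite tnth_mktuple comp_mpolyXU -tnth_nth tnth_mktuple (unsplitK (inr i)).
Qed.
End Inclusions.

#[local] Obligation Tactic := idtac.

Section MF3.
Variable R : idomainType.

Record mf3 (f : R) := MF3 {
  mf_size : nat;
  mf_phi : 'M[{fraction R}]_mf_size;
  mf_psi : 'M[{fraction R}]_mf_size;
  mf_theta : 'M[{fraction R}]_mf_size;
  mf_mul : mf_phi *m mf_psi *m mf_theta = (f%:F)%:M
}.

Section Hom.
Variable f : R.
Implicit Types X Y Z T : mf3 f.

Record mf3_hom X Y := MF3Hom {
  mf_alpha : 'M[{fraction R}]_(mf_size Y, mf_size X);
  mf_beta : 'M[{fraction R}]_(mf_size Y, mf_size X);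
  mf_delta : 'M[{fraction R}]_(mf_size Y, mf_size X);
  mf_alphaP : mf_alpha *m mf_phi X = mf_phi Y *m mf_beta;
  mf_betaP : mf_psi Y *m mf_delta = mf_beta *m mf_psi X;
  mf_deltaP : mf_delta *m mf_theta X = mf_theta Y *m mf_alpha
}.

Lemma mf3_hom_eq X Y (u v : mf3_hom X Y) :
    mf_alpha u = mf_alpha v -> mf_beta u = mf_beta v -> mf_delta u = mf_delta v ->
  u = v.
Proof.
case: u v => [a b d p q r] [a' b' d' p' q' r'] /= ea eb ed.
move: p q r p' q' r'; rewrite ea eb ed => p q r p' q' r'.
by rewrite (eq_irrelevance p p') (eq_irrelevance q q') (eq_irrelevance r r').
Qed.

Program Definition mf3_id X : mf3_hom X X := @MF3Hom X X 1%:M 1%:M 1%:M _ _ _.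
Next Obligation. by move=> X; rewrite mul1mx mulmx1. Qed.
Next Obligation. by move=> X; rewrite mul1mx mulmx1. Qed.
Next Obligation. by move=> X; rewrite mul1mx mulmx1. Qed.

Program Definition mf3_comp X Y Z (v : mf3_hom Y Z) (u : mf3_hom X Y) : mf3_hom X Z :=
  @MF3Hom X Z (mf_alpha v *m mf_alpha u) (mf_beta v *m mf_beta u)
    (mf_delta v *m mf_delta u) _ _ _.
Next Obligation. by move=> X Y Z v u; rewrite -mulmxA mf_alphaP !mulmxA mf_alphaP. Qed.
Next Obligation. by move=> X Y Z v u; rewrite mulmxA mf_betaP -!mulmxA mf_betaP. Qed.
Next Obligation. by move=> X Y Z v u; rewrite -mulmxA mf_deltaP !mulmxA mf_deltaP. Qed.

Lemma mf3_compA X Y Z T (w : mf3_hom Z T) (v : mf3_hom Y Z) (u : mf3_hom X Y) :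
  mf3_comp w (mf3_comp v u) = mf3_comp (mf3_comp w v) u.
Proof. by apply: mf3_hom_eq; rewrite /= mulmxA. Qed.

Lemma mf3_comp1l X Y (u : mf3_hom X Y) : mf3_comp (mf3_id Y) u = u.
Proof. by apply: mf3_hom_eq; rewrite /= mul1mx. Qed.

Lemma mf3_comp1r X Y (u : mf3_hom X Y) : mf3_comp u (mf3_id X) = u.
Proof. by apply: mf3_hom_eq; rewrite /= mulmx1. Qed.

Definition mf3_is_iso X Y (u : mf3_hom X Y) : Prop :=
  exists v : mf3_hom Y X, mf3_comp v u = mf3_id X /\ mf3_comp u v = mf3_id Y.
End Hom.

Lemma tens_scalar_scalar (a b : {fraction R}) k l :
  (a%:M : 'M_k) *t (b%:M : 'M_l) = (a * b)%:M.
Proof.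
apply/matrixP=> i j; case: (mxtens_indexP i) => i1 i2; case: (mxtens_indexP j) => j1 j2.
rewrite tensmxE !mxE (inj_eq (can_inj (@mxtens_indexK _ _))) xpair_eqE.
by case: eqP => _; case: eqP => _; rewrite ?mulr0n ?mulr1n ?mul0r ?mulr0.
Qed.

(* Since p * q and q * p are not convertible, the product is passed as a
   parameter r, so that both orders of the factors yield objects of the same
   category. *)
Section Tensor.
Variables (p q r : R) (pqr : p * q = r).

Program Definition mf3_tens (X : mf3 p) (Y : mf3 q) : mf3 r :=
  @MF3 r (mf_size X * mf_size Y)%N (mf_phi X *t mf_phi Y) (mf_psi X *t mf_psi Y)
    (mf_theta X *t mf_theta Y) _.
Next Obligation.
by move=> X Y; rewrite !tensmx_mul !mf_mul tens_scalar_scalar -tofracM pqr.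
Qed.

Program Definition mf3_tens_hom (X1 X2 : mf3 p) (Y1 Y2 : mf3 q)
    (u : mf3_hom X1 X2) (v : mf3_hom Y1 Y2) :
    mf3_hom (mf3_tens X1 Y1) (mf3_tens X2 Y2) :=
  @MF3Hom r (mf3_tens X1 Y1) (mf3_tens X2 Y2) (mf_alpha u *t mf_alpha v)
    (mf_beta u *t mf_beta v) (mf_delta u *t mf_delta v) _ _ _.
Next Obligation. by move=> X1 X2 Y1 Y2 u v; rewrite /= !tensmx_mul !mf_alphaP. Qed.
Next Obligation. by move=> X1 X2 Y1 Y2 u v; rewrite /= !tensmx_mul !mf_betaP. Qed.
Next Obligation. by move=> X1 X2 Y1 Y2 u v; rewrite /= !tensmx_mul !mf_deltaP. Qed.
End Tensor.
End MF3.

Section Extension.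
Variables (R S : idomainType) (h : {rmorphism R -> S}) (hI : injective h) (f : R).

Program Definition mf3_ext (X : mf3 f) : mf3 (h f) :=
  @MF3 S (h f) (mf_size X) (map_mx (fracmap hI) (mf_phi X))
    (map_mx (fracmap hI) (mf_psi X)) (map_mx (fracmap hI) (mf_theta X)) _.
Next Obligation. by move=> X; rewrite -!map_mxM mf_mul map_scalar_mx /= fracmapF. Qed.

Program Definition mf3_ext_hom (X Y : mf3 f) (u : mf3_hom X Y) :
    mf3_hom (mf3_ext X) (mf3_ext Y) :=
  @MF3Hom S (h f) (mf3_ext X) (mf3_ext Y) (map_mx (fracmap hI) (mf_alpha u))
    (map_mx (fracmap hI) (mf_beta u)) (map_mx (fracmap hI) (mf_delta u)) _ _ _.
Next Obligation. by move=> X Y u; rewrite /= -!map_mxM mf_alphaP. Qed.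
Next Obligation. by move=> X Y u; rewrite /= -!map_mxM mf_betaP. Qed.
Next Obligation. by move=> X Y u; rewrite /= -!map_mxM mf_deltaP. Qed.
End Extension.

Section MultiplicativeTensor.
Variables (K : fieldType) (m n : nat) (f : {mpoly K[m]}) (g : {mpoly K[n]}).

Definition mf3_prod : {mpoly K[m + n]} := inx K m n f * iny K m n g.

Definition tens_xy (X : mf3 f) (X' : mf3 g) : mf3 mf3_prod :=
  mf3_tens (erefl mf3_prod)
    (mf3_ext (@inx_inj K m n) X) (mf3_ext (@iny_inj K m n) X').

Definition tens_yx (X' : mf3 g) (X : mf3 f) : mf3 mf3_prod :=
  mf3_tens (mulrC (iny K m n g) (inx K m n f))
    (mf3_ext (@iny_inj K m n) X') (mf3_ext (@inx_inj K m n) X).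

Definition tens_xy_hom (X1 X2 : mf3 f) (X1' X2' : mf3 g)
    (u : mf3_hom X1 X2) (u' : mf3_hom X1' X2') :
    mf3_hom (tens_xy X1 X1') (tens_xy X2 X2') :=
  mf3_tens_hom (erefl mf3_prod)
    (mf3_ext_hom (@inx_inj K m n) u) (mf3_ext_hom (@iny_inj K m n) u').

Definition tens_yx_hom (X1' X2' : mf3 g) (X1 X2 : mf3 f)
    (u' : mf3_hom X1' X2') (u : mf3_hom X1 X2) :
    mf3_hom (tens_yx X1' X1) (tens_yx X2' X2) :=
  mf3_tens_hom (mulrC (iny K m n g) (inx K m n f))
    (mf3_ext_hom (@iny_inj K m n) u') (mf3_ext_hom (@inx_inj K m n) u).
End MultiplicativeTensor.

(* Main.v *)
Require Import Defs.
From HB Require Import structures.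
From mathcomp Require Import all_boot all_order all_algebra fraction.
From mathcomp Require Import mxtens mpoly.

(** The Kronecker products [A *t B] and [B *t A] have the same entries, up to
    one and the same relabelling of the rows and of the columns: the swap
    (i, j) |-> (j, i) of pairs of indices. In matrix terms, the permutation
    matrix of the swap, the commutation matrix [swap_mx], intertwines the two
    products ([swap_mx_tens]); the entries must commute, since [a * b] is
    compared with [b * a].

    The commutation matrix depends on the sizes of [A] and [B] alone, and this
    gives everything. Taken as each of the three components of a triplet, it
    satisfies the three equations of a morphism, which are instances of the
    intertwining identity for the matrices of the two factorizations. It is
    natural by the same identity, applied to the matrices of the morphisms.
    It is invertible because the swap is an involution ([swap_mxK]). The
    argument makes sense for factorizations over any integral domain; the two
    lists of indeterminates enter only when it is applied to the extensions of
    the two factorizations to K(x, y). *)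

Set Implicit Arguments.
Unset Strict Implicit.
Unset Printing Implicit Defensive.

Import GRing.Theory.
Local Open Scope ring_scope.

Definition swap_index k l (i : 'I_(k * l)) : 'I_(l * k) :=
  mxtens_index ((mxtens_unindex i).2, (mxtens_unindex i).1).

Lemma swap_indexE k l (i : 'I_k) (j : 'I_l) :
  swap_index (mxtens_index (i, j)) = mxtens_index (j, i).
Proof. by rewrite /swap_index mxtens_indexK. Qed.

Lemma swap_indexK k l : cancel (@swap_index k l) (@swap_index l k).
Proof. by move=> i; case: (mxtens_indexP i) => a b; rewrite !swap_indexE. Qed.

Section SwapMatrix.
Variable R : comNzRingType.

(** Multiplication by this matrix on the left carries the row order of
    [A *t B] to that of [B *t A], for [A] with [k] rows and [B] with [l]. *)
Definition swap_mx k l : 'M[R]_(l * k, k * l) := rowsub (@swap_index l k) 1%:M.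

(** A permutation matrix read by columns belongs to the inverse permutation,
    which here is the swap of the opposite shape. This form computes products
    with the matrix on the right. *)
Lemma swap_mx_colsub k l : swap_mx k l = colsub (@swap_index k l) 1%:M.
Proof.
apply/matrixP=> i j; rewrite !mxE; congr (_%:R); congr (nat_of_bool _).
by rewrite (can2_eq (@swap_indexK l k) (@swap_indexK k l)).
Qed.

(** Both products have at row (b, a) and column (a', b') an entry made of
    [A a a'] and [B b b'], in one order and in the other. *)
Lemma swap_mx_tens k k' l l' (A : 'M[R]_(k, k')) (B : 'M[R]_(l, l')) :
  swap_mx k l *m (A *t B) = (B *t A) *m swap_mx k' l'.
Proof.
rewrite [in RHS]swap_mx_colsub mul_rowsub_mx mulmx_colsub mul1mx mulmx1.
apply/matrixP=> i j; rewrite !mxE.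
case: (mxtens_indexP i) => b a; case: (mxtens_indexP j) => a' b'.
by rewrite !swap_indexE !mxtens_indexK mulrC.
Qed.

Lemma swap_mxK k l : swap_mx l k *m swap_mx k l = 1%:M.
Proof.
rewrite mul_rowsub_mx mul1mx; apply/matrixP=> i j.
by rewrite !mxE swap_indexK.
Qed.
End SwapMatrix.

Section SwapMorphism.
Variables (R : idomainType) (p q r : R) (pqr : p * q = r) (qpr : q * p = r).

Definition mf3_swap (X : mf3 p) (Y : mf3 q) :
    mf3_hom (mf3_tens pqr X Y) (mf3_tens qpr Y X) :=
  @MF3Hom R r (mf3_tens pqr X Y) (mf3_tens qpr Y X)
    (swap_mx _ _ _) (swap_mx _ _ _) (swap_mx _ _ _)
    (swap_mx_tens _ _) (esym (swap_mx_tens _ _)) (swap_mx_tens _ _).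

Lemma mf3_swap_natural (X1 X2 : mf3 p) (Y1 Y2 : mf3 q)
    (u : mf3_hom X1 X2) (v : mf3_hom Y1 Y2) :
  mf3_comp (mf3_swap X2 Y2) (mf3_tens_hom pqr u v) =
  mf3_comp (mf3_tens_hom qpr v u) (mf3_swap X1 Y1).
Proof. by apply: mf3_hom_eq; apply: swap_mx_tens. Qed.
End SwapMorphism.

(** The inverse is the swap of the factors in the opposite order, whence the
    exchange of the two hypotheses on the product. *)
Lemma mf3_swapK (R : idomainType) (p q r : R) (pqr : p * q = r)
    (qpr : q * p = r) (X : mf3 p) (Y : mf3 q) :
  mf3_comp (mf3_swap qpr pqr Y X) (mf3_swap pqr qpr X Y) =
  mf3_id (mf3_tens pqr X Y).
Proof. by apply: mf3_hom_eq; apply: swap_mxK. Qed.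

Lemma mf3_swap_iso (R : idomainType) (p q r : R) (pqr : p * q = r)
    (qpr : q * p = r) (X : mf3 p) (Y : mf3 q) :
  mf3_is_iso (mf3_swap pqr qpr X Y).
Proof. by exists (mf3_swap qpr pqr Y X); split; apply: mf3_swapK. Qed.

Theorem proposition5p2 (K : fieldType) (m n : nat)
    (f : {mpoly K[m]}) (g : {mpoly K[n]}) :
  exists c : forall (X : mf3 f) (X' : mf3 g), mf3_hom (tens_xy X X') (tens_yx X' X),
    (forall (X : mf3 f) (X' : mf3 g), mf3_is_iso (c X X')) /\
    (forall (X1 X2 : mf3 f) (X1' X2' : mf3 g)
        (u : mf3_hom X1 X2) (u' : mf3_hom X1' X2'),
      mf3_comp (c X2 X2') (tens_xy_hom u u') = mf3_comp (tens_yx_hom u' u) (c X1 X1')).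
Proof.
exists (fun X X' => mf3_swap _ _ (mf3_ext _ X) (mf3_ext _ X')); split.
  by move=> X X'; apply: mf3_swap_iso.
by move=> X1 X2 X1' X2' u u'; apply: mf3_swap_natural.
Qed.
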